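(* Let $r>0$. If $E<\infty$, then $$\lim_{n\to\infty}\frac{\underline{u}_r}{\underline{E}}=\frac{1}{e^{r}},$$ where, for each $n>-\xi$, $\underline{u}_r$ is the optimal price and $\underline{E}=E+n$ the expectation of the game $(a(x)+n,F(x))$.
   Context: A game $(a(x),F(x))$ consists of a distribution function $F$ on an interval $I\subseteq(-\infty,\infty)$ with $\int_I dF=1$ (Lebesgue–Stieltjes integral, $dF=d(F(x))$) and a measurable profit function $a:I\to\mathbb{R}$ that is not a.e. constant with respect to $F$. Put $E=\int_I a(x)\,dF$, $H=\int_I \frac{1}{a(x)}\,dF$, $\xi=\operatorname{ess\,inf}_{x\in I}a(x)$ (with respect to $F$), and $H_\xi=\int_I\frac{1}{a(x)-\xi}\,dF$, with the convention $H_\xi=\infty$ and $1/H_\xi=0$ if $\int_{a(x)=\xi}dF>0$ (and $1/\infty=0$ generally). Standing assumption: $\xi>0$. One has $\xi\le \xi+1/H_\xi<1/H<E$. For $u\in(\xi+1/H_\xi,E)$, the pre-optimal proportion $\widetilde{t}_u$ is the unique $t\in(0,u/(u-\xi))$ satisfying $\int_I\frac{a(x)-u}{a(x)t-ut+u}\,dF=0$ (existence and uniqueness are known). For $u\in(\xi+1/H_\xi,E)$ and $t\in(0,u/(u-\xi))$, the pre-growth rate is $\widetilde{G}_u(t)=\exp\left(\int_I\log\left(\frac{a(x)t}{u}-t+1\right)dF\right)$. Standing assumption: these pre-growth rates are finite (equivalently $\int_{a(x)>1}\log a(x)\,dF<+\infty$). The maximized limit expectation of the growth rate at price $u$ is $\widetilde{G}_u(\widetilde{t}_u)$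 for $u\in(1/H,E)$ and $\exp\left(\int_I\log a(x)\,dF\right)/u$ for $u\in(0,1/H]$. For a riskless continuously compounded interest rate $r>0$ (for a period), the optimal price $u_r$ of the game is the unique $u\in(0,E)$ at which the maximized limit expectation of the growth rate equals $e^r$ (existence and uniqueness are known). For a real number $n>-\xi$, the game with parallel translated profit is $(a(x)+n,F(x))$; underlined symbols denote the same quantities for this game: $\underline{E}=E+n$, $\underline{H}=\int_I\frac{1}{a(x)+n}\,dF$, $\underline{\xi}=\xi+n$, $\underline{H}_{\underline{\xi}}=\int_I\frac{1}{(a(x)+n)-(\xi+n)}\,dF=H_\xi$; for $v\in(\underline{\xi}+1/\underline{H}_{\underline{\xi}},\underline{E})$, $\widetilde{\underline{t}}_v$ is the unique $t\in(0,v/(v-\underline{\xi}))$ satisfying $\int_I\frac{a(x)+n-v}{(a(x)+n)t-vt+v}\,dF=0$, and $\underline{\widetilde{G}}_v(t)=\exp\left(\int_I\log\left(\frac{(a(x)+n)t}{v}-t+1\right)dF\right)$ for $t\in(0,v/(v-\underline{\xi}))$. The maximized limit expectation of the growth rate of the translated game at price $v$ is $\underline{\widetilde{G}}_v(\widetilde{\underline{t}}_v)$ for $v\in(1/\underline{H},\underline{E})$ and $\exp\left(\int_I\log(a(x)+n)\,dF\right)/v$ for $v\in(0,1/\underline{H}]$, and $\underline{u}_r$ is its optimal price for the same $r$, i.e. the unique $v\in(0,\underline{E})$ at which this maximized limit expectation of the growth rate equals $e^r$. *)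

(* Defs.v *)
From HB Require Import structures.
From mathcomp Require Import all_boot all_order all_algebra.
From mathcomp Require Import all_classical all_reals all_analysis.

Set Implicit Arguments.
Unset Strict Implicit.
Unset Printing Implicit Defensive.

Import Order.TTheory GRing.Theory Num.Theory.
Import numFieldNormedType.Exports.

Local Open Scope classical_set_scope.
Local Open Scope ring_scope.

(* The Lebesgue-Stieltjes measure dF.  The completed measure is used, so that
   "measurable" means dF-measurable; Borel functions are a particular case. *)
Notation dF F := (completed_lebesgue_stieltjes_measure F).

Section game.
Context {d : measure_display} {T : measurableType d} {R : realType}.
Variables (mu : {measure set T -> \bar R}) (I : set T) (a : T -> R).
Implicit Types (r u t : R) (g : \bar R).

(* mu is only required to have mass 1 on I: nothing is assumed outside I,
   hence every "almost everywhere" below is relativized to I. *)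
Definition is_game : Prop :=
  [/\ mu I = 1%E, measurable_fun I a &
      ~ exists c : R, {ae mu, forall x, I x -> a x = c}].

Definition game_E : \bar R := (\int[mu]_(x in I) (a x)%:E)%E.

Definition game_H : \bar R := (\int[mu]_(x in I) (a x)^-1%:E)%E.

(* [ess_inf] of the library, relativized to I. *)
Definition game_xi : \bar R :=
  ereal_sup [set y | {ae mu, forall x, I x -> (y <= (a x)%:E)%E}].

Local Notation xi := (fine game_xi).

Definition game_Hxi : \bar R :=
  (if (0 < mu (I `&` [set x | a x = xi]))%E then +oo
   else \int[mu]_(x in I) (a x - xi)^-1%:E)%E.

Definition is_pre_optimal u t : Prop :=
  0 < t < u / (u - xi) /\
  (\int[mu]_(x in I) ((a x - u) / (a x * t - u * t + u))%:E = 0)%E.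

Definition pre_growth u t : \bar R :=
  expeR (\int[mu]_(x in I) (ln (a x * t / u - t + 1))%:E)%E.

(* The inverses of [game_H] and [game_Hxi] are taken in \bar R, where
   +oo^-1 = 0. *)
Definition finite_pre_growth : Prop :=
  forall u t, (game_xi + game_Hxi^-1 < u%:E < game_E)%E ->
    0 < t < u / (u - xi) -> pre_growth u t \is a fin_num.

(* g is the maximized limit expectation of the growth rate at price u. *)
Definition is_max_growth u g : Prop :=
  ((game_H^-1 < u%:E < game_E)%E /\
     exists2 t, is_pre_optimal u t & g = pre_growth u t) \/
  ((0 < u%:E <= game_H^-1)%E /\
     g = (expeR (\int[mu]_(x in I) (ln (a x))%:E) * u^-1%:E)%E).

Definition is_optimal_price r u : Prop :=
  (0 < u%:E < game_E)%E /\ is_max_growth u (expR r)%:E.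

End game.

(* Main.v *)
Require Import Defs.
From mathcomp Require Import all_boot all_order all_algebra.
From mathcomp Require Import all_classical all_reals all_analysis.
From mathcomp Require Import measurable_realfun ess_sup_inf lra ring.
Import Order.TTheory GRing.Theory Num.Theory.
Import numFieldNormedType.Exports.
Local Open Scope classical_set_scope.
Local Open Scope ring_scope.

(** After translation by a large n the profit is nearly constant in relative
    terms: prices above 1/H are then too close to the expectation for the game
    to grow at rate r, so the optimal price is the explicit one below 1/H, a
    discounted geometric mean.  Quantitatively, take a game with profit
    b >= m > 0 almost everywhere and expectation e.

    At a price u > 1/H the derivative of the log growth at t = 1, which is
    int (b - u)/b = 1 - u H, is negative, and this derivative is nonincreasing
    in t; hence the pre-optimal proportion t is less than 1
    ([pre_optimal_lt1]).  Since ln (1 + x) <= x, the log growth at t is then at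
    most (e/u - 1) t <= (e - u)/u <= (e - m)/m ([log_growth_le]).  So when
    (e - m)/m < r, no price above 1/H attains growth exp r, and the optimal
    price satisfies u exp r = exp (int ln b), which lies between m and e by
    monotonicity and Jensen's inequality ([optimal_price_bounds]).

    For b = a + n one takes m = n and e = E + n, so that (e - m)/m = E/n < r
    for n large.  Therefore n <= u_n exp r <= E + n, and dividing by E + n
    squeezes u_n / (E + n) to exp (- r). *)

(** * Real inequalities and measurability *)

Lemma measurable_invr (R : realType) : measurable_fun [set: R] (@GRing.inv R).
Proof.
have -> : [set: R] = ~` [set 0] `|` [set 0] by rewrite setvU.
apply/measurable_funU => //; first exact: measurableC.
split; last exact: measurable_fun_set1.
apply: open_continuous_measurable_fun; first exact/closed_openC/closed_eq.
by move=> x; rewrite inE /= => /eqP x0; exact: inv_continuous.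
Qed.

(** The tangent of ln at e, with the right-hand side arranged as an affine
    function of x; integrating it at e = int x gives Jensen's inequality
    for ln. *)
Lemma ln_le_tangent (R : realType) (e x : R) : 0 < e -> 0 < x ->
  ln x <= e^-1 * x + (ln e - 1).
Proof.
move=> e0 x0; have xe0 : 0 < x / e by rewrite divr_gt0.
have /le_ln1Dx : -1 < x / e - 1 by lra.
by rewrite addrCA subrr addr0 ln_div ?posrE//; lra.
Qed.

(** The integrand defining the pre-optimal proportion is nonincreasing in t:
    its value at t >= 1 is compared with its value (b - u)/b at 1.  The
    difference of the cross products is (b - u)^2 (t - 1). *)
Lemma relative_excess_le (R : realFieldType) (b u t : R) :
  1 <= t -> 0 < b -> 0 < b * t - u * t + u ->
  (b - u) / (b * t - u * t + u) <= - u * b^-1 + 1.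
Proof.
move=> t1 b0 d0.
have -> : - u * b^-1 + 1 = (b - u) / b by field; rewrite gt_eqF.
rewrite ler_pdivrMr// mulrAC ler_pdivlMr// -subr_ge0.
have -> : (b - u) * (b * t - u * t + u) - (b - u) * b =
          (b - u) ^+ 2 * (t - 1) by ring.
by rewrite mulr_ge0 ?sqr_ge0 ?subr_ge0.
Qed.

(** * Integrals over a set of measure one *)

Section integral_lemmas.
Context {d : measure_display} {T : measurableType d} {R : realType}.
Variables (mu : {measure set T -> \bar R}) (D : set T).
Hypothesis mD : measurable D.

(** Valid for all measurable functions: the positive parts increase and the
    negative parts decrease, and subtraction of extended reals is monotone even
    when it involves infinities.  The logarithms and quotients below can
    therefore be compared without first being shown integrable. *)
Lemma ae_le_integral (f g : T -> \bar R) :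
  measurable_fun D f -> measurable_fun D g ->
  {ae mu, forall x, D x -> (f x <= g x)%E} ->
  (\int[mu]_(x in D) f x <= \int[mu]_(x in D) g x)%E.
Proof.
move=> mf mg fg; rewrite (integralE _ _ f) (integralE _ _ g).
apply: leeB; apply: ae_ge0_le_integral => //;
  do ?[exact: measurable_funepos | exact: measurable_funeneg].
- apply: filterS fg => x /[apply] fg.
  by rewrite !funeposE ge_max !le_max fg lexx orbT.
- apply: filterS fg => x /[apply] fg.
  by rewrite !funenegE ge_max !le_max leeN2 fg lexx orbT.
Qed.

Hypothesis D1 : mu D = 1%E.

Lemma integral_affine (f : T -> R) (p q : R) :
  mu.-integrable D (EFin \o f) ->
  (\int[mu]_(x in D) (p * f x + q)%:E =
   (p * fine (\int[mu]_(x in D) (f x)%:E) + q)%:E)%E.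
Proof.
move=> intf.
have intq : mu.-integrable D (EFin \o cst q).
  apply/integrableP; split; first exact/measurable_EFinP.
  by rewrite (integral_cst mu mD `|q|%:E) D1 mule1 ltry.
under eq_integral do rewrite EFinD EFinM.
rewrite integralD//; last exact: integrableZl.
rewrite integralZl// (integral_cst mu mD q%:E) D1 mule1.
by rewrite -[X in (_ * X)%E]fineK// integrable_fin_num.
Qed.

Lemma ae_ge_integral (f : T -> R) (p : R) : measurable_fun D f ->
  {ae mu, forall x, D x -> p <= f x} ->
  (p%:E <= \int[mu]_(x in D) (f x)%:E)%E.
Proof.
move=> mf pf; rewrite -[leLHS]mule1 -D1 -(integral_cst mu mD p%:E).
apply: ae_le_integral; [exact/measurable_EFinP..|].
by apply: filterS pf => x /[apply]; rewrite lee_fin.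
Qed.

Lemma ae_integral_le (f : T -> R) (q : R) : measurable_fun D f ->
  {ae mu, forall x, D x -> f x <= q} ->
  (\int[mu]_(x in D) (f x)%:E <= q%:E)%E.
Proof.
move=> mf fq; rewrite -[leRHS]mule1 -D1 -(integral_cst mu mD q%:E).
apply: ae_le_integral; [exact/measurable_EFinP..|].
by apply: filterS fq => x /[apply]; rewrite lee_fin.
Qed.

Lemma ae_nonneg_integrable (f : T -> R) : measurable_fun D f ->
  {ae mu, forall x, D x -> 0 <= f x} ->
  (\int[mu]_(x in D) (f x)%:E < +oo)%E -> mu.-integrable D (EFin \o f).
Proof.
move=> mf f0 foo; apply/integrableP; split; first exact/measurable_EFinP.
apply: le_lt_trans foo; apply: ae_le_integral.
- exact/measurable_EFinP/measurableT_comp.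
- exact/measurable_EFinP.
- by apply: filterS f0 => x /[apply] fx; rewrite /= ger0_norm.
Qed.

End integral_lemmas.

(** * Optimal prices of a game bounded away from zero *)

Section game_lemmas.
Context {d : measure_display} {T : measurableType d} {R : realType}.
Variables (mu : {measure set T -> \bar R}) (I : set T).

(** The supremum defining the relativized essential infimum is attained,
    because it is an ordinary essential infimum once the profit is extended by
    +oo outside I. *)
Lemma ae_ge_game_xi (a : T -> R) :
  {ae mu, forall x, I x -> (game_xi mu I a <= (a x)%:E)%E}.
Proof.
pose g x := if x \in I then (a x)%:E else +oo%E.
have -> : game_xi mu I a = ess_inf mu g.
  congr ereal_sup; apply/seteqP; split => y /=; apply: filterS => x; rewrite /g.
    by case: ifPn => [/set_mem Ix /(_ Ix)//|_ _]; rewrite leey.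
  by move=> h Ix; rewrite mem_set in h.
apply: filterS (ess_inf_le mu g) => x + Ix.
by rewrite /g mem_set.
Qed.

Hypotheses (mI : measurable I) (I1 : mu I = 1%E).

(** The essential infimum is a real number: +oo would force I to be null.  So
    the real number by which the upper end of the range of t is defined is the
    essential infimum itself rather than a default value. *)
Lemma game_xi_ge (b : T -> R) (m : R) :
  {ae mu, forall x, I x -> m <= b x} ->
  exists2 xi, game_xi mu I b = xi%:E & m <= xi.
Proof.
move=> mb; have mxi : (m%:E <= game_xi mu I b)%E.
  by apply: ereal_sup_ubound; apply: filterS mb => x /[apply]; rewrite lee_fin.
move: mxi (ae_ge_game_xi b); case: game_xi => [xi| |].
- by rewrite lee_fin => mxi _; exists xi.
- move=> _ boo; have : mu I = 0%E.
    apply/negligibleP => //; apply: negligibleS boo => x Ix /(_ Ix).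
    by rewrite leye_eq.
  by rewrite I1 => /eqP; rewrite onee_eq0.
- by rewrite leeNy_eq.
Qed.

Section bounded_below.
Variables (b : T -> R) (m : R).
Hypotheses (mb : measurable_fun I b) (m0 : 0 < m).
Hypothesis m_le_b : {ae mu, forall x, I x -> m <= b x}.

(** Were t >= 1, the equation defining t would give
    0 <= int (b - u)/b = 1 - u H, whereas u > 1/H.  The price exceeds m because
    1/H is a harmonic mean of values of b. *)
Lemma pre_optimal_lt1 (u t : R) : ((game_H mu I b)^-1 < u%:E)%E ->
  is_pre_optimal mu I b u t -> m <= u /\ 0 < t < 1.
Proof.
move=> Hu [/andP[t0 tu] opt].
have [xi xiE mxi] := game_xi_ge b m m_le_b.
have xib : {ae mu, forall x, I x -> xi <= b x}.
  by apply: filterS (ae_ge_game_xi b) => x /[apply]; rewrite xiE lee_fin.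
rewrite xiE /= in tu.
have xi0 : 0 < xi by exact: lt_le_trans mxi.
have mV : measurable_fun I (fun x => (b x)^-1).
  by apply: measurableT_comp => //; exact: measurable_invr.
have V0 : {ae mu, forall x, I x -> 0 <= (b x)^-1}.
  by apply: filterS xib => x /[apply] /(lt_le_trans xi0) /ltW; rewrite invr_ge0.
have Vxi : {ae mu, forall x, I x -> (b x)^-1 <= xi^-1}.
  apply: filterS xib => x /[apply] xibx.
  by rewrite lef_pV2// posrE (lt_le_trans xi0).
have H0 := ae_ge_integral mu I mI I1 _ _ mV V0.
have Hxi := ae_integral_le mu I mI I1 _ _ mV Vxi.
have intV : mu.-integrable I (EFin \o (fun x => (b x)^-1)).
  apply: ae_nonneg_integrable => //; exact: le_lt_trans Hxi (ltry _).
have [h hE] : exists h, game_H mu I b = h%:E.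
  exists (fine (game_H mu I b)); rewrite fineK//.
  by rewrite /game_H integrable_fin_num.
move: Hu H0 Hxi; rewrite -/(game_H mu I b) hE !lee_fin inver.
case: eqVneq => // hn0; rewrite lte_fin => hu h0 hxi.
have {h0 hn0} h0 : 0 < h by rewrite lt_neqAle eq_sym hn0.
have xiu : xi < u.
  by apply: le_lt_trans hu; rewrite -[xi]invrK lef_pV2 ?posrE ?invr_gt0.
split; first exact/ltW/(le_lt_trans mxi).
rewrite t0 ltNge; apply/negP => t1.
(* t < u / (u - xi) says exactly that the denominator of the pre-optimality
   integrand is positive where b is smallest. *)
have d0 : 0 < xi * t - u * t + u.
  by move: tu; rewrite ltr_pdivlMr ?subr_gt0//; nra.
have : (0 <= (- u * h + 1)%:E)%E; last first.
  rewrite lee_fin; apply/negP; rewrite -ltNge.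
  by move: hu; rewrite -[h^-1]mul1r ltr_pdivrMr//; lra.
have -> : h = fine (\int[mu]_(x in I) (b x)^-1%:E)%E.
  by rewrite -/(game_H mu I b) hE.
rewrite -(integral_affine mu I mI I1)// -opt.
apply: ae_le_integral => //.
- apply/measurable_EFinP; apply: measurable_funM; first exact: measurable_funB.
  apply: (measurableT_comp (measurable_invr R)).
  apply: measurable_funD => //; apply: measurable_funB => //.
  exact: measurable_funM.
- apply/measurable_EFinP; apply: measurable_funD => //.
  exact: measurable_funM.
- apply: filterS xib => x /[apply] xibx; rewrite lee_fin.
  apply: relative_excess_le => //.
    exact: lt_le_trans xibx.
  by apply: lt_le_trans d0 _; rewrite !lerD2r ler_wpM2r// ltW.
Qed.

Variable e : R.
Hypothesis Ee : game_E mu I b = e%:E.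

Let intb : mu.-integrable I (EFin \o b).
Proof.
apply: ae_nonneg_integrable => //; last by rewrite -/(game_E mu I b) Ee ltry.
by apply: filterS m_le_b => x /[apply] /(le_trans (ltW m0)).
Qed.

Let fineE : fine (\int[mu]_(x in I) (b x)%:E)%E = e.
Proof. by rewrite -/(game_E mu I b) Ee. Qed.

(** With t < 1 the argument of ln exceeds 1 - t > 0 wherever b > 0, so
    ln (1 + x) <= x applies with x = (b - u) t / u. *)
Lemma log_growth_le (u t : R) : 0 < u -> 0 < t < 1 ->
  (\int[mu]_(x in I) (ln (b x * t / u - t + 1))%:E <= ((e / u - 1) * t)%:E)%E.
Proof.
move=> u0 /andP[t0 t1].
have -> : (e / u - 1) * t = (t / u) * e + - t by ring.
rewrite -fineE -(integral_affine mu I mI I1)//.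
have mf : measurable_fun I (fun x => b x * t / u - t + 1).
  apply: measurable_funD => //; apply: measurable_funB => //.
  by apply: measurable_funM => //; apply: measurable_funM.
apply: ae_le_integral => //.
- by apply/measurable_EFinP; apply: measurableT_comp mf; exact: measurable_ln.
- apply/measurable_EFinP; apply: measurable_funD => //.
  exact: measurable_funM.
- apply: filterS m_le_b => x /[apply] mbx; rewrite lee_fin addrC.
  have bt0 : 0 < b x * t / u by rewrite divr_gt0// mulr_gt0// (lt_le_trans m0).
  apply: le_trans (le_ln1Dx _) _; first by lra.
  lra.
Qed.

Lemma log_growth_bounds :
  ((ln m)%:E <= \int[mu]_(x in I) (ln (b x))%:E <= (ln e)%:E)%E.
Proof.
have mln : measurable_fun I (fun x => ln (b x)).
  by apply: measurableT_comp mb; exact: measurable_ln.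
have e0 : 0 < e.
  by apply: lt_le_trans m0 _; rewrite -lee_fin -Ee; exact: ae_ge_integral.
apply/andP; split.
  apply: ae_ge_integral => //; apply: filterS m_le_b => x /[apply] mbx.
  by rewrite ler_ln ?posrE// (lt_le_trans m0).
(* Jensen: ln e is the integral of the tangent of ln at the mean e. *)
have -> : ln e = e^-1 * e + (ln e - 1) by rewrite mulVf ?gt_eqF//; ring.
rewrite -[X in _ * X + _]fineE -(integral_affine mu I mI I1)//.
apply: ae_le_integral => //.
- exact/measurable_EFinP.
- apply/measurable_EFinP; apply: measurable_funD => //.
  exact: measurable_funM.
- apply: filterS m_le_b => x /[apply] mbx; rewrite lee_fin ln_le_tangent//.
  exact: lt_le_trans mbx.
Qed.

(** The hypothesis excludes a price above 1/H, where the growth rate is too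
    small to reach exp r; below 1/H the price is an explicit geometric mean. *)
Lemma optimal_price_bounds (r u : R) : e - m < r * m ->
  is_optimal_price mu I b r u -> m <= u * expR r <= e.
Proof.
have expE (x : R) : expeR x%:E = (expR x)%:E by [].
move=> emr [/andP[u0 ue] [[/andP[Hu _] [t tu]]|]].
  (* Here r u <= (e - u) t <= e - u <= e - m < r m <= r u. *)
  have [m_le_u t01] := pre_optimal_lt1 u t Hu tu.
  rewrite -expE => /expeR_inj rE; rewrite lte_fin in u0.
  rewrite Ee lte_fin in ue.
  have := log_growth_le u t u0 t01; rewrite -rE lee_fin => rle.
  have : r * u <= (e - u) * t.
    by move: rle; rewrite -(ler_pM2r u0) mulrAC mulrBl divfK ?gt_eqF// mul1r.
  have r0 : 0 < r by rewrite -(pmulr_lgt0 _ m0); apply: le_lt_trans emr; lra.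
  have : (e - u) * t <= e - u by case/andP: t01 => _ t1; rewrite ler_piMr; lra.
  by have : r * m <= r * u; [rewrite ler_pM2l | lra].
move=> [_]; have /andP[] := log_growth_bounds.
case: integral => [l| |] //; rewrite !lee_fin => ml le.
rewrite expE -EFinM => -[->]; rewrite lte_fin in u0.
rewrite mulrCA divff ?gt_eqF// mulr1.
have e0 : 0 < e by rewrite -lte_fin -Ee; exact: lt_trans ue.
by rewrite -(lnK m0) -(lnK e0) !ler_expR ml.
Qed.

End bounded_below.

(** * Translated games and the limit *)

Section translation.
Variable a : T -> R.
Hypotheses (ma : measurable_fun I a) (xi_gt0 : (0 < game_xi mu I a)%E).
Hypothesis E_fin : (game_E mu I a < +oo)%E.

Let E := fine (game_E mu I a).

Let a_ge0 : {ae mu, forall x, I x -> 0 <= a x}.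
Proof.
apply: filterS (ae_ge_game_xi a) => x /[apply] xia.
by rewrite -lee_fin (le_trans (ltW xi_gt0)).
Qed.

Lemma game_E_ge0 : (0 <= game_E mu I a)%E.
Proof. exact: ae_ge_integral. Qed.

Lemma game_E_translate (n : R) :
  game_E mu I (fun x => a x + n) = (E + n)%:E.
Proof.
rewrite /game_E; under eq_integral do rewrite -[a _]mul1r.
by rewrite (integral_affine mu I mI I1) ?mul1r//; exact: ae_nonneg_integrable.
Qed.

Lemma translated_price_bounds (r n v : R) : 0 < n -> E < r * n ->
  is_optimal_price mu I (fun x => a x + n) r v -> n <= v * expR r <= E + n.
Proof.
move=> n0 nE; apply: optimal_price_bounds => //.
- exact: measurable_funD.
- by apply: filterS a_ge0 => x /[apply] ax; rewrite lerDr.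
- exact: game_E_translate.
- by rewrite addrK.
Qed.

End translation.
End game_lemmas.

Theorem theorem2p7 (R : realType) (I : interval R) (F : cumulative R R)
    (a : R -> R) (r : R) (u : R -> R)
    (game_a : is_game (dF F) [set` I] a)
    (xi_gt0 : (0 < game_xi (dF F) [set` I] a)%E)
    (growth_fin : finite_pre_growth (dF F) [set` I] a)
    (r_gt0 : 0 < r)
    (E_fin : (game_E (dF F) [set` I] a < +oo)%E)
    (u_opt : forall n : R, (- game_xi (dF F) [set` I] a < n%:E)%E ->
       is_optimal_price (dF F) [set` I] (fun x => a x + n) r (u n)) :
  u n / fine (game_E (dF F) [set` I] (fun x => a x + n)) @[n --> +oo]
    --> (expR r)^-1.
Proof.
have mI : measurable ([set` I] : set (caratheodory_type (wlength F)^*%mu)).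
  by apply: sub_caratheodory; exact: measurable_itv.
move: game_a => [I1 ma _].
pose E := fine (game_E (dF F) [set` I] a).
have E0 : 0 <= E by rewrite fine_ge0//; exact: game_E_ge0.
under eq_fun do
  rewrite (game_E_translate (dF F) _ mI I1 a ma xi_gt0 E_fin) -/E /=.
have bounds : \forall n \near +oo,
    (expR r)^-1 * (1 - E / (E + n)) <= u n / (E + n) <= (expR r)^-1.
  near=> n.
  have n0 : 0 < n by near: n; exact: nbhs_pinfty_gt.
  have nE : E < r * n.
    rewrite mulrC -ltr_pdivrMr//; near: n; apply: nbhs_pinfty_gt.
    by rewrite num_real.
  have /u_opt un : (- game_xi (dF F) [set` I] a < n%:E)%E.
    by rewrite (@lt_trans _ _ 0%E) ?lte_fin// oppe_lt0.
  have /andP[] := translated_price_bounds (dF F) _ mI I1 a ma xi_gt0 E_fin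
    r n (u n) n0 nE un.
  have En0 : 0 < E + n by rewrite ltr_wpDl.
  have er0 := expR_gt0 r.
  have -> : 1 - E / (E + n) = n / (E + n) by field; rewrite gt_eqF.
  move=> lo hi; apply/andP; split.
    by rewrite mulrA ler_pM2r ?invr_gt0// mulrC ler_pdivrMr.
  by rewrite ler_pdivrMr// mulrC ler_pdivlMr.
apply: (squeeze_cvgr bounds); last exact: cvg_cst.
have {2}-> : (expR r)^-1 = (expR r)^-1 * (1 - E * 0).
  by rewrite mulr0 subr0 mulr1.
apply: cvgM; first exact: cvg_cst.
apply: cvgB; first exact: cvg_cst.
apply: cvgM; first exact: cvg_cst.
apply/(gtr0_cvgV0 (f := fun n => E + n)); last exact: cvg_addrl.
by near=> n; rewrite ltr_wpDl//; near: n; exact: nbhs_pinfty_gt.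
Unshelve. all: end_near. Qed.
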